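(* Let $s_*:=1+W_0(e^{-1})$, where $W_0$ is the principal branch of the Lambert $W$ function. Let $s_K\approx0.5878$ be the unique positive solution of $e^s(e^{2s}-1+2se^s)=(1+e^s)^2$, and define $K:(0,s_*]\to(0,e^{2s_*}]$ by \[ K(s):=\begin{cases}\dfrac{e^s(e^{2s}-1+2se^s)}{(1+e^s)^2}, & s\in(0,s_K],\\[2mm] \xi(s), & s\in(s_K,s_*],\end{cases} \] where $\xi(s)$ is the unique solution $\xi\in[1,e^{2s_*}]$ of $(e^s-\xi)\ln\xi+\xi(3+e^{-s})=e^s(e^s+2s-1)$. Then for every $s\in(0,s_*]$ there exists a $(\rho(s),\chi(s))$-excursion profile with \[ \rho(s)=\frac{1+e^s}{2s},\qquad \chi(s)=\begin{cases}\dfrac{e^{2s}-1-2s}{2s(1+e^s)}=\rho(s)K(s)e^{-s}-1, & s\in(0,s_K],\\[2mm] \dfrac{e^{2s}+1+(1+K(s))\ln K(s)-2K(s)-2s}{2s(1+e^s)}, & s\in(s_K,s_*].\end{cases} \]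
   Context: For $\rho\ge\chi>0$, a $(\rho,\chi)$-excursion profile is a pair $G_\pm=(G_+,G_-)$ of non-decreasing, left-continuous functions $G_+,G_-:\mathbb{R}\to(0,\infty)$ such that (plus-offset) $G_+(x)\ge1$ for every $x>0$ and $G_+(x)<1$ for every $x<0$; (robustness) $C_+(x)\le\rho\,G_+(x)$ and $C_-(x)\le\rho\,G_-(x)$ for all $x\in\mathbb{R}$; (consistency) $C_+(0)\le\chi$; where $C_+(x):=\int_{-\infty}^{x}G_+(t)\,\mathrm{d} t+\int_{-\infty}^{x}G_-(t)\,\mathrm{d} t$ and $C_-(x):=\int_{-\infty}^{x+1}G_+(t)\,\mathrm{d} t+\int_{-\infty}^{x}G_-(t)\,\mathrm{d} t$. *)

(* Defs.v *)
From HB Require Import structures.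
From mathcomp Require Import all_boot all_order all_algebra.
From mathcomp Require Import all_classical all_reals all_analysis.
Set Implicit Arguments. Unset Strict Implicit. Unset Printing Implicit Defensive.
Import Order.TTheory GRing.Theory Num.Theory.
Import numFieldNormedType.Exports.
Local Open Scope classical_set_scope.
Local Open Scope ring_scope.

Section Defs.
Variable R : realType.

Definition LambertW0 (y : R) : R :=
  xget 0 [set w : R | -1 <= w /\ w * expR w = y].

Definition s_star : R := 1 + LambertW0 (expR (-1)).

Definition s_K : R :=
  xget 0 [set s : R | 0 < s /\
    expR s * (expR (2 * s) - 1 + 2 * s * expR s) = (1 + expR s) ^+ 2].

Definition xi (s : R) : R :=
  xget 0 [set x : R | 1 <= x /\ x <= expR (2 * s_star) /\
    (expR s - x) * ln x + x * (3 + expR (- s)) = expR s * (expR s + 2 * s - 1)].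

Definition Kfun (s : R) : R :=
  if s <= s_K then expR s * (expR (2 * s) - 1 + 2 * s * expR s) / (1 + expR s) ^+ 2
  else xi s.

Definition rho (s : R) : R := (1 + expR s) / (2 * s).

Definition chi (s : R) : R :=
  if s <= s_K then (expR (2 * s) - 1 - 2 * s) / (2 * s * (1 + expR s))
  else (expR (2 * s) + 1 + (1 + Kfun s) * ln (Kfun s) - 2 * Kfun s - 2 * s)
         / (2 * s * (1 + expR s)).

Definition Cplus (Gp Gm : R -> R) (x : R) : \bar R :=
  (\int[lebesgue_measure]_(t in `]-oo, x%R]) (Gp t)%:E +
   \int[lebesgue_measure]_(t in `]-oo, x%R]) (Gm t)%:E)%E.

Definition Cminus (Gp Gm : R -> R) (x : R) : \bar R :=
  (\int[lebesgue_measure]_(t in `]-oo, (x + 1)%R]) (Gp t)%:E +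
   \int[lebesgue_measure]_(t in `]-oo, x%R]) (Gm t)%:E)%E.

Definition nondecr_leftcont_pos (G : R -> R) : Prop :=
  [/\ {homo G : x y / x <= y},
      (forall x, 0 < G x) &
      (forall x, G t @[t --> x^'-] --> G x)].

(* (rho, chi)-excursion profile (notion defined for rho >= chi > 0). *)
Definition excursion_profile (rh ch : R) (Gp Gm : R -> R) : Prop :=
  [/\ 0 < ch /\ ch <= rh,
      nondecr_leftcont_pos Gp /\ nondecr_leftcont_pos Gm,
      (forall x, 0 < x -> 1 <= Gp x) /\ (forall x, x < 0 -> Gp x < 1),
      (forall x, (Cplus Gp Gm x <= (rh * Gp x)%:E)%E /\
                 (Cminus Gp Gm x <= (rh * Gm x)%:E)%E) &
      (Cplus Gp Gm 0 <= ch%:E)%E].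

End Defs.

(* Main.v *)
(* For [x > 0] take the exponential profile [G-(x) = K e^(2sx-s)] and
   [G+(x) = max(1, K e^(2s(x-1)))], which grows at the rate [2s] for which
   robustness is tight.  For [x <= 0] take the least solution of the equations
   [rho G+ = C+], [rho G- = C-], obtained as the limit of the monotone iteration
   started at [0].  Testing the iteration against the weight [e^(-2sx)], the
   adjoint eigenfunction at the same rate, yields
   [(1 + e^s) C+(0) <= \int_0^1 (e^(2s(1-t)) - 1) G+(t) dt] for every iterate, and
   the right-hand side is [(1 + e^s) chi].  The equation defining [xi] says that
   [C-(0) <= rho G-(0+)] is then an equality, which makes the two halves fit
   together; on [0 < s <= s_K] the value [1] is used in place of [K], where this
   inequality has slack. *)
Require Import Defs.
From HB Require Import structures.
From mathcomp Require Import all_boot all_order all_algebra.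
From mathcomp Require Import all_classical all_reals all_analysis.
From mathcomp Require Import measurable_realfun.
From mathcomp Require Import ring lra.
Set Implicit Arguments. Unset Strict Implicit. Unset Printing Implicit Defensive.
Import Order.TTheory GRing.Theory Num.Theory.
Import numFieldNormedType.Exports.
Local Open Scope classical_set_scope.
Local Open Scope ring_scope.

(** * Integrals over left half-lines and their weighted (Laplace) identity *)

Section Integrals.
Context {R : realType}.
Local Notation mu := (@lebesgue_measure R).

Lemma is_derive_expR_scale (a b x : R) :
  is_derive x 1 (fun t => a * expR (b * t)) (a * (b * expR (b * x))).
Proof. by apply: is_derive_eq; rewrite /GRing.scale/=; ring. Qed.

Lemma continuous_expR_scale (a b : R) : continuous (fun t => a * expR (b * t)).
Proof.
move=> x; have /derivable1_diffP/differentiable_continuous// :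
  derivable (fun t => a * expR (b * t)) x 1 by have [] := is_derive_expR_scale a b x.
Qed.

Lemma integral_expR_scale (a b c d : R) : b != 0 -> c <= d ->
  (\int[mu]_(t in `]c, d]) (a * expR (b * t))%:E =
   (a / b * (expR (b * d) - expR (b * c)))%:E)%E.
Proof.
move=> b0; rewrite le_eqVlt => /predU1P[->|cd].
  by rewrite set_itvoc0 integral_set0 subrr mulr0.
rewrite integral_itv_obnd_cbnd; last first.
  apply/measurable_EFinP; apply: measurable_funTS => //.
  apply: continuous_measurable_fun; exact: continuous_expR_scale.
rewrite (@continuous_FTC2 _ (fun t => a * expR (b * t)) (fun t => a / b * expR (b * t)))//.
- by rewrite -EFinB -mulrBr.
- apply: continuous_subspaceT => x; exact: continuous_expR_scale.
- split.
  + by move=> x _; have [] := is_derive_expR_scale (a / b) b x.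
  + exact/cvg_at_right_filter/continuous_expR_scale.
  + exact/cvg_at_left_filter/continuous_expR_scale.
- move=> x _; rewrite derive1E; have [_ ->] := is_derive_expR_scale (a / b) b x.
  by field.
Qed.

(** Extended-real values let the iterates be handled before their integrals are known to be
    finite. *)
Definition cumulative (f : R -> \bar R) (x : R) : \bar R :=
  (\int[mu]_(t in `]-oo, x]) f t)%E.

(** Moving the moving endpoint into the integrand makes [cumulative] a partial integral of a
    function on the plane, the form in which Tonelli applies. *)
Lemma cumulative_if (f : R -> \bar R) x :
  cumulative f x = (\int[mu]_t (if (t <= x)%R then f t else 0))%E.
Proof.
rewrite /cumulative integral_mkcond; apply: eq_integral => t _.
by rewrite patchE; congr (if _ then _ else _); rewrite mem_setE in_itv.
Qed.

Lemma measurable_halfplane (f : R -> \bar R) (c : R) :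
  measurable_fun setT f ->
  measurable_fun [set: R * R] (fun p => if p.2 <= p.1 + c then f p.2 else 0%E).
Proof.
move=> mf; apply: measurable_fun_ifT => //.
- apply: measurable_fun_ler; first exact: measurable_snd.
  by apply: measurable_funD => //; exact: measurable_fst.
- by apply: measurableT_comp => //; exact: measurable_snd.
Qed.

Lemma measurable_cumulative (f : R -> \bar R) (c : R) :
  measurable_fun setT f -> (forall x, 0 <= f x)%E ->
  measurable_fun setT (fun x : R => cumulative f (x + c)).
Proof.
move=> mf f0.
have := @measurable_fun_fubini_tonelli_F _ _ _ _ R mu _
  (measurable_halfplane c mf).
rewrite /fubini_F /= => H.
under eq_fun do rewrite cumulative_if.
by apply: H => p; case: ifP.
Qed.

(* Tonelli; the inner integral of [l * expR (- l * x)] over [t - c <= x <= 0]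
   telescopes to [expR (l * (c - t)) - 1]. *)
Lemma cumulative_laplace (f : R -> \bar R) (l c : R) : 0 < l -> 0 <= c ->
  measurable_fun setT f -> (forall x, 0 <= f x)%E ->
  (\int[mu]_(x in `]-oo, 0%R]) ((l * expR (- l * x))%:E * cumulative f (x + c))
     + cumulative f c =
   \int[mu]_(t in `]-oo, c]) ((expR (l * (c - t)))%:E * f t))%E.
Proof.
move=> l0 c0 mf f0.
pose w (x : R) : \bar R := if x <= 0 then (l * expR (- l * x))%:E else 0%E.
have e0 x : (0 <= (l * expR (- l * x))%:E)%E.
  by rewrite lee_fin mulr_ge0 ?expR_ge0// ltW.
have w0 x : (0 <= w x)%E by rewrite /w; case: ifP.
have me : measurable_fun setT (fun x : R => (l * expR (- l * x))%:E).
  apply/measurable_EFinP; apply: continuous_measurable_fun.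
  exact: continuous_expR_scale.
have mw : measurable_fun setT w.
  apply: measurable_fun_ifT; [|exact: me|exact: measurable_cst].
  by apply: measurable_fun_ler => //; exact: measurable_id.
pose h (p : R * R) : \bar R :=
  (w p.1 * (if (p.2 <= p.1 + c)%R then f p.2 else 0))%E.
have mh : measurable_fun setT h.
  apply: emeasurable_funM; last exact: measurable_halfplane.
  exact: (measurableT_comp mw measurable_fst).
have h0 p : (0 <= h p)%E by rewrite /h mule_ge0//; case: ifP.
have L : (\int[mu]_(x in `]-oo, 0%R])
    ((l * expR (- l * x))%:E * cumulative f (x + c)) =
    \int[mu]_x \int[mu]_y h (x, y))%E.
  rewrite integral_mkcond; apply: eq_integral => x _.
  have -> : (\int[mu]_y h (x, y) = w x * cumulative f (x + c))%E.
    rewrite cumulative_if -ge0_integralZl//; last by move=> t _; case: ifP.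
    apply: measurable_fun_ifT => //.
    by apply: measurable_fun_ler => //; exact: measurable_id.
  rewrite patchE mem_setE in_itv/= /w; case: ifP => //; by rewrite mul0e.
rewrite L (@fubini_tonelli _ _ _ _ R mu mu h mh h0).
rewrite /cumulative [X in (_ + X)%E]integral_mkcond [RHS]integral_mkcond.
rewrite -ge0_integralD//; last 4 first.
- by move=> x _; apply: integral_ge0.
- exact: (@measurable_fun_fubini_tonelli_G _ _ _ _ R mu h mh h0).
- by move=> x _; rewrite patchE; case: ifP.
- exact/(measurable_restrictT _ _).1/measurable_funTS.
apply: eq_integral => t _; rewrite !patchE mem_setE in_itv/=.
have hE : (\int[mu]_x h (x, t) =
    f t * \int[mu]_x (if (t - c <= x)%R && (x <= 0)%R
                      then (l * expR (- l * x))%:E else 0))%E.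
  rewrite -ge0_integralZl//.
  - apply: eq_integral => x _; rewrite /h/w/= lerBlDr.
    by case: (t <= _); case: (x <= _); rewrite /= ?mule0 ?mul0e// muleC.
  - apply: measurable_fun_ifT; [|exact: me|exact: measurable_cst].
    apply: measurable_and.
      by apply: measurable_fun_ler => //; exact: measurable_id.
    by apply: measurable_fun_ler => //; exact: measurable_id.
  - by move=> x _; case: ifP.
(* For [t > c] no [x] satisfies [t - c <= x <= 0], so the inner integral vanishes. *)
rewrite hE; case: ifPn => tc; last first.
  rewrite (_ : (fun x => _) = cst 0%E) ?integral0 ?mule0 ?adde0//.
  apply/funext => x /=; case: ifPn => // /andP[].
  by move: tc; rewrite -ltNge => /= ? ? ?; exfalso; lra.
have -> : (\int[mu]_x (if (t - c <= x)%R && (x <= 0)%R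
                      then (l * expR (- l * x))%:E else 0) =
    (expR (l * (c - t)) - 1)%:E)%E.
  transitivity (\int[mu]_(x in `[(t - c)%R, 0%R]) (l * expR (- l * x))%:E)%E.
    rewrite [RHS]integral_mkcond; apply: eq_integral => x _.
    by rewrite patchE mem_setE in_itv.
  rewrite -integral_itv_obnd_cbnd; last exact: measurable_funTS.
  rewrite integral_expR_scale; last 2 first.
    by rewrite oppr_eq0 gt_eqF.
    by rewrite subr_le0.
  congr (_%:E); rewrite mulr0 expR0 (_ : - l * (t - c) = l * (c - t)); last by ring.
  by field; rewrite gt_eqF.
rewrite -[X in (_ + X)%E]mule1 -ge0_muleDr//.
  by rewrite -EFinD subrK muleC.
by rewrite lee_fin subr_ge0 -expR0 ler_expR mulr_ge0 ?subr_ge0// ltW.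
Qed.

Lemma cumulative_ge0 (f : R -> \bar R) x :
  (forall t, 0 <= f t)%E -> (0 <= cumulative f x)%E.
Proof. by move=> f0; apply: integral_ge0 => t _. Qed.

Lemma cumulative_split (f : R -> \bar R) x y : measurable_fun setT f ->
  (forall t, 0 <= f t)%E -> x <= y ->
  (cumulative f y = cumulative f x + \int[mu]_(t in `]x, y]) f t)%E.
Proof.
move=> mf f0 xy; rewrite /cumulative.
rewrite (@itv_bndbnd_setU _ _ -oo%O (BRight x) (BRight y))//.
rewrite ge0_integral_setU//; first exact: measurable_funTS.
apply/disj_set2P; rewrite -subset0 => t [/=]; rewrite !in_itv/= => tx /andP[xt _].
by move: (le_lt_trans tx xt); rewrite ltxx.
Qed.

Lemma integral_oc_split (f : R -> \bar R) x y z : measurable_fun setT f ->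
  (forall t, `]x, z]%classic t -> 0 <= f t)%E -> x <= y -> y <= z ->
  (\int[mu]_(t in `]x, z]) f t =
   \int[mu]_(t in `]x, y]) f t + \int[mu]_(t in `]y, z]) f t)%E.
Proof.
move=> mf f0 xy yz.
have E := @itv_bndbnd_setU _ _ (BRight x) (BRight y) (BRight z) xy yz.
rewrite E ge0_integral_setU//; first exact: measurable_funTS.
- by rewrite -E.
apply/disj_set2P; rewrite -subset0 => t [/=]; rewrite !in_itv/=.
by move=> /andP[_ ty] /andP[yt _]; move: (le_lt_trans ty yt); rewrite ltxx.
Qed.

Lemma le_cumulative (f : R -> \bar R) x y : measurable_fun setT f ->
  (forall t, 0 <= f t)%E -> x <= y -> (cumulative f x <= cumulative f y)%E.
Proof.
move=> mf f0 xy; rewrite (cumulative_split mf f0 xy) leeDl//.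
by apply: integral_ge0.
Qed.

Lemma le_cumulative_fun (f g : R -> \bar R) x :
  measurable_fun setT f -> measurable_fun setT g ->
  (forall t, 0 <= f t)%E -> (forall t, f t <= g t)%E ->
  (cumulative f x <= cumulative g x)%E.
Proof.
move=> mf mg f0 fg; apply: ge0_le_integral => //; exact: measurable_funTS.
Qed.

Lemma cumulative_limn (f : nat -> R -> \bar R) x :
  (forall n, measurable_fun setT (f n)) -> (forall n t, 0 <= f n t)%E ->
  (forall n t, f n t <= f n.+1 t)%E ->
  cumulative (f n) x @[n --> \oo] --> cumulative (fun t => limn (f ^~ t)) x.
Proof.
move=> mf f0 nd; apply: cvg_monotone_convergence => //.
- by move=> n; apply: measurable_funTS; exact: mf.
- by move=> t _; apply: (iffLR (nondecreasing_seqP (f^~ t))) => n; exact: nd.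
Qed.

End Integrals.

(** * Monotone iteration for the balance equations on the left half-line *)

Section Iteration.
Context {R : realType}.
Variables (rh : R) (gp gm : R -> R).
Hypothesis rh0 : 0 < rh.
Hypothesis gp0 : forall x, 0 <= gp x.
Hypothesis gm0 : forall x, 0 <= gm x.
Hypothesis mgp : measurable_fun setT gp.
Hypothesis mgm : measurable_fun setT gm.
Local Notation mu := (@lebesgue_measure R).
Implicit Types p : (R -> \bar R) * (R -> \bar R).

(** A fixed point solves [rh * G+ = C+] and [rh * G- = C-] on [x <= 0], with data [gp], [gm]
    prescribed on [x > 0]. Only the shift by one in [C-] lets data enter the left half-line: the
    values of [gp] on []0, 1]] act as the source. *)
Definition profile_step p : (R -> \bar R) * (R -> \bar R) :=
  (fun x => if x <= 0
            then (rh^-1%:E * (cumulative p.1 x + cumulative p.2 x))%E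
            else (gp x)%:E,
   fun x => if x <= 0
            then (rh^-1%:E * (cumulative p.1 (x + 1)%R + cumulative p.2 x))%E
            else (gm x)%:E).

(** Vanishing on [x <= 0] puts the start below its own image, so the iterates increase, and gives
    them finite (zero) Laplace transforms at the outset. *)
Definition profile_init : (R -> \bar R) * (R -> \bar R) :=
  (fun x => if x <= 0 then 0%E else (gp x)%:E,
   fun x => if x <= 0 then 0%E else (gm x)%:E).

Definition profile_iter n := iter n profile_step profile_init.

Definition nonneg_measurable p :=
  [/\ measurable_fun setT p.1, measurable_fun setT p.2,
      (forall x, 0 <= p.1 x)%E & (forall x, 0 <= p.2 x)%E].

Let rhV0 : (0 <= (rh^-1)%:E)%E. Proof. by rewrite lee_fin invr_ge0 ltW. Qed.

Let measurable_le0 : measurable_fun setT (fun x : R => x <= 0).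
Proof. by apply: measurable_fun_ler => //; exact: measurable_id. Qed.

Lemma nonneg_measurable_init : nonneg_measurable profile_init.
Proof.
split => /=.
- apply: measurable_fun_ifT => //; exact/measurable_EFinP.
- apply: measurable_fun_ifT => //; exact/measurable_EFinP.
- by move=> x; case: ifP => // _; rewrite lee_fin.
- by move=> x; case: ifP => // _; rewrite lee_fin.
Qed.

Lemma nonneg_measurable_step p :
  nonneg_measurable p -> nonneg_measurable (profile_step p).
Proof.
move=> [m1 m2 p1 p2].
have mc (f : R -> \bar R) : measurable_fun setT f ->
    (forall x, 0 <= f x)%E -> measurable_fun setT (cumulative f).
  move=> mf f0; have := measurable_cumulative 0 mf f0.
  by under eq_fun do rewrite addr0.
split => /=.
- apply: measurable_fun_ifT => //; last exact/measurable_EFinP.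
  by apply: measurable_funeM; apply: emeasurable_funD; exact: mc.
- apply: measurable_fun_ifT => //; last exact/measurable_EFinP.
  apply: measurable_funeM; apply: emeasurable_funD; last exact: mc.
  exact: measurable_cumulative.
- move=> x; case: ifP => _; last by rewrite lee_fin.
  by rewrite mule_ge0// adde_ge0// cumulative_ge0.
- move=> x; case: ifP => _; last by rewrite lee_fin.
  by rewrite mule_ge0// adde_ge0// cumulative_ge0.
Qed.

Lemma profile_iter_nonneg n : nonneg_measurable (profile_iter n).
Proof.
elim: n => [|n IH]; first exact: nonneg_measurable_init.
exact: nonneg_measurable_step.
Qed.

Lemma profile_step_mono p q : nonneg_measurable p -> nonneg_measurable q ->
  (forall x, p.1 x <= q.1 x)%E -> (forall x, p.2 x <= q.2 x)%E ->
  (forall x, (profile_step p).1 x <= (profile_step q).1 x)%E /\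
  (forall x, (profile_step p).2 x <= (profile_step q).2 x)%E.
Proof.
move=> [p1 p2 p3 p4] [q1 q2 q3 q4] h1 h2; split => x /=; case: ifP => // _;
  by rewrite lee_wpmul2l// leeD//; exact: le_cumulative_fun.
Qed.

Lemma profile_iter_mono n :
  (forall x, (profile_iter n).1 x <= (profile_iter n.+1).1 x)%E /\
  (forall x, (profile_iter n).2 x <= (profile_iter n.+1).2 x)%E.
Proof.
elim: n => [|n [IH1 IH2]]; last first.
  apply: (profile_step_mono _ _ IH1 IH2).
    exact: (profile_iter_nonneg n).
  exact: (profile_iter_nonneg n.+1).
have [m1 m2 p1 p2] := nonneg_measurable_init.
by split => x /=; case: ifP => // _;
  rewrite mule_ge0// adde_ge0// cumulative_ge0.
Qed.

Lemma profile_iter_pos n x : 0 < x ->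
  (profile_iter n).1 x = (gp x)%:E /\ (profile_iter n).2 x = (gm x)%:E.
Proof. by move=> x0; case: n => [|n] /=; rewrite leNgt x0. Qed.

(** * The Laplace-transform bound on [C+(0)] along the iteration *)

Section Bound.
Variables (s fhat fbar : R).
Hypothesis s0 : 0 < s.
Hypothesis rhE : 2 * s * rh = 1 + expR s.
Hypothesis fhatE :
  (\int[mu]_(t in `]0%R, 1%R]) ((expR (2 * s * (1 - t)))%:E * (gp t)%:E) = fhat%:E)%E.
Hypothesis fbarE : (\int[mu]_(t in `]0%R, 1%R]) (gp t)%:E = fbar%:E)%E.

(** The exponent is written with [0 - t] to be the case [c = 0] of the weight in
    [cumulative_laplace]. *)
Definition laplace (f : R -> \bar R) : \bar R :=
  (\int[mu]_(t in `]-oo, 0%R]) ((expR (2 * s * (0 - t)))%:E * f t))%E.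

Lemma laplace_ge0 f : (forall x, 0 <= f x)%E -> (0 <= laplace f)%E.
Proof.
by move=> f0; apply: integral_ge0 => t _; rewrite mule_ge0// lee_fin expR_ge0.
Qed.

Let measurable_weight c : measurable_fun setT
  (fun t : R => (expR (2 * s * (c - t)))%:E : \bar R).
Proof.
apply/measurable_EFinP; apply: measurableT_comp; first exact: measurable_expR.
apply: measurable_funM => //; exact: measurable_funB.
Qed.

Let measurable_weightM c f : measurable_fun setT f ->
  measurable_fun setT (fun t : R => (expR (2 * s * (c - t)))%:E * f t)%E.
Proof. by move=> mf; apply: emeasurable_funM; first exact: measurable_weight. Qed.

Lemma le_laplace f g : measurable_fun setT f -> measurable_fun setT g ->
  (forall x, 0 <= f x)%E -> (forall x, f x <= g x)%E ->
  (laplace f <= laplace g)%E.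
Proof.
move=> mf mg f0 fg; apply: ge0_le_integral => //.
- by move=> t _; rewrite mule_ge0// lee_fin expR_ge0.
- apply: measurable_funTS; exact: measurable_weightM.
- apply: measurable_funTS; exact: measurable_weightM.
- by move=> t _; rewrite lee_wpmul2l// lee_fin expR_ge0.
Qed.

Let s20 : 0 < 2 * s. Proof. by rewrite mulr_gt0. Qed.

Let kernel (x : R) : \bar R := (2 * s * expR (- (2 * s) * x))%:E.

Let kernel_ge0 x : (0 <= kernel x)%E.
Proof. by rewrite lee_fin mulr_ge0 ?expR_ge0// ltW. Qed.

Let measurable_kernel : measurable_fun setT kernel.
Proof.
apply/measurable_EFinP; apply: continuous_measurable_fun.
exact: continuous_expR_scale.
Qed.

Let measurable_kernelM f : measurable_fun setT f ->
  measurable_fun setT (fun t => kernel t * f t)%E.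
Proof. by move=> mf; apply: emeasurable_funM; first exact: measurable_kernel. Qed.

Let laplaceE c f : 0 <= c -> measurable_fun setT f -> (forall x, 0 <= f x)%E ->
  (\int[mu]_(t in `]-oo, c]) ((expR (2 * s * (c - t)))%:E * f t) =
   \int[mu]_(x in `]-oo, 0%R]) (kernel x * cumulative f (x + c)%R)
     + cumulative f c)%E.
Proof. by move=> c0 mf f0; rewrite -cumulative_laplace. Qed.

Let scale_laplace f : measurable_fun setT f -> (forall x, 0 <= f x)%E ->
  ((2 * s * rh)%:E * laplace f =
    \int[mu]_(x in `]-oo, 0%R]) (kernel x * (rh%:E * f x)))%E.
Proof.
move=> mf f0; rewrite /laplace -ge0_integralZl//; last 3 first.
- apply: measurable_funTS; exact: measurable_weightM.
- by move=> t _; rewrite mule_ge0// lee_fin expR_ge0.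
- by rewrite lee_fin mulr_ge0// ltW.
apply: eq_integral => x _; rewrite !muleA -!EFinM; congr (_%:E * _)%E.
by rewrite sub0r mulrN mulNr; ring.
Qed.

Let laplaceD f g c : measurable_fun setT f -> (forall x, 0 <= f x)%E ->
  measurable_fun setT g -> (forall x, 0 <= g x)%E ->
  (\int[mu]_(x in `]-oo, 0%R]) (kernel x * cumulative f (x + c)%R) +
  \int[mu]_(x in `]-oo, 0%R]) (kernel x * cumulative g (x + 0)%R) =
  \int[mu]_(x in `]-oo, 0%R])
     (kernel x * (cumulative f (x + c)%R + cumulative g x)))%E.
Proof.
move=> mf f0 mg g0; rewrite -ge0_integralD; last first.
- apply: measurable_funTS; apply: measurable_kernelM; exact: measurable_cumulative.
- by move=> x _; apply: mule_ge0; [exact: kernel_ge0|exact: cumulative_ge0].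
- apply: measurable_funTS; apply: measurable_kernelM; exact: measurable_cumulative.
- by move=> x _; apply: mule_ge0; [exact: kernel_ge0|exact: cumulative_ge0].
- by [].
apply: eq_integral => x _; rewrite addr0.
by rewrite (ge0_muleDr _ (cumulative_ge0 _ f0) (cumulative_ge0 _ g0)).
Qed.

(** On [x <= 0], [rh] times the new first component is the sum of the two cumulative integrals.
    Integrating this against [kernel] and applying [cumulative_laplace] at [c = 0] turns each of
    them back into a Laplace transform, up to the boundary terms at [0]. *)
Lemma profile_step_laplace1 p : nonneg_measurable p ->
  ((2 * s * rh)%:E * laplace (profile_step p).1
    + (cumulative p.1 0%R + cumulative p.2 0%R) = laplace p.1 + laplace p.2)%E.
Proof.
move=> np; have [m1 m2 p1 p2] := np; have [n1 n2 q1 q2] := nonneg_measurable_step np.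
rewrite [laplace p.1]laplaceE// [laplace p.2]laplaceE// [RHS]addeACA.
rewrite (laplaceD 0 m1 p1 m2 p2) scale_laplace//; congr (_ + _)%E.
apply: eq_integral => x; rewrite inE/= in_itv/= => x0; rewrite x0 addr0.
by congr (_ * _)%E; rewrite muleA -EFinM divff ?gt_eqF// mul1e.
Qed.

(** The same computation with the first cumulative integral shifted by one, so [cumulative_laplace]
    is used at [c = 1]. Splitting []-oo, 1]] at [0], the left part picks up the factor [e^(2s)], and
    the prescribed values on []0, 1]] contribute [fhat] to the weighted integral and [fbar] to the
    boundary term. *)
Lemma profile_step_laplace2 p : nonneg_measurable p ->
  (forall x, 0 < x -> p.1 x = (gp x)%:E) ->
  ((2 * s * rh)%:E * laplace (profile_step p).2
    + (cumulative p.1 0%R + cumulative p.2 0%R) + fbar%:E =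
   (expR s ^+ 2)%:E * laplace p.1 + laplace p.2 + fhat%:E)%E.
Proof.
move=> np pgp; have [m1 m2 p1 p2] := np; have [n1 n2 q1 q2] := nonneg_measurable_step np.
have E1 : (cumulative p.1 1%R = cumulative p.1 0%R + fbar%:E)%E.
  rewrite (cumulative_split m1 p1 ler01) -fbarE; congr (_ + _)%E.
  apply: eq_integral => x; rewrite inE/= in_itv/= => /andP[x0 _]; exact: pgp.
have E2 : (\int[mu]_(t in `]-oo, 1%R]) ((expR (2 * s * (1 - t)))%:E * p.1 t) =
    (expR s ^+ 2)%:E * laplace p.1 + fhat%:E)%E.
  have w0 x : (0 <= (expR (2 * s * (1 - x)))%:E * p.1 x)%E.
    by rewrite mule_ge0// lee_fin expR_ge0.
  have := @cumulative_split R _ 0 1 (measurable_weightM 1 m1) w0 ler01.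
  rewrite /cumulative => ->; congr (_ + _)%E.
    rewrite /laplace -ge0_integralZl//; last 2 first.
    + apply: measurable_funTS; exact: measurable_weightM.
    + by move=> t _; rewrite mule_ge0// lee_fin expR_ge0.
    apply: eq_integral => x _; rewrite muleA -EFinM -expRM_natl -expRD.
    by congr ((expR _)%:E * _)%E; ring.
  rewrite -fhatE; apply: eq_integral => x; rewrite inE/= in_itv/= => /andP[x0 _].
  by rewrite pgp.
rewrite [RHS]addeAC -E2 laplaceE// [laplace p.2]laplaceE// [RHS]addeACA.
rewrite (laplaceD 1 m1 p1 m2 p2) scale_laplace// E1.
have aux (w x y z : \bar R) : (w + (x + y) + z = w + (x + z + y))%E.
  by rewrite -!addeA [(y + z)%E]addeC.
rewrite [LHS]aux; congr (_ + _)%E.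
apply: eq_integral => x; rewrite inE/= in_itv/= => x0; rewrite x0.
by congr (_ * _)%E; rewrite muleA -EFinM divff ?gt_eqF// mul1e.
Qed.

Let fin_num_summands (k : R) (x y z : \bar R) : 0 < k -> (0 <= x)%E -> (0 <= y)%E ->
  z \is a fin_num -> (k%:E * x + y = z)%E -> x \is a fin_num /\ y \is a fin_num.
Proof.
move=> k0 x0 y0 zf E; move: zf; rewrite -E fin_numD => /andP[kx ->]; split => //.
move: kx; rewrite !ge0_fin_numE//; last by rewrite mule_ge0// lee_fin ltW.
by case: x x0 E => [r| |]// _ _; rewrite ?ltry// gt0_muley ?lte_fin.
Qed.

(** Induction on [n]: in both step identities the right-hand side is finite and all terms on the
    left are nonnegative, so the transforms of the next iterate are finite. This licenses the
    subtractions in [profile_iter_bound]. *)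
Lemma profile_iter_laplace_fin n :
  laplace (profile_iter n).1 \is a fin_num /\
  laplace (profile_iter n).2 \is a fin_num.
Proof.
have krh : 0 < 2 * s * rh by rewrite mulr_gt0.
elim: n => [|n [IH1 IH2]].
  have L0 f : (forall x, x <= 0 -> f x = 0%E) -> laplace f = 0%E.
    move=> f0; apply: integral0_eq => x /=; rewrite in_itv/= => x0.
    by rewrite f0// mule0.
  by rewrite !L0// => x /= ->.
have np := profile_iter_nonneg n; have [_ _ p1 p2] := np.
have [_ _ q1 q2] := profile_iter_nonneg n.+1.
have C0 : (0 <= cumulative (profile_iter n).1 0%R
              + cumulative (profile_iter n).2 0%R)%E.
  by apply: adde_ge0; exact: cumulative_ge0.
split.
  have F : (laplace (profile_iter n).1 + laplace (profile_iter n).2)%E \is a fin_num.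
    by rewrite fin_numD IH1.
  by have [] := fin_num_summands krh (laplace_ge0 q1) C0 F (profile_step_laplace1 np).
have := profile_step_laplace2 np (fun x x0 => (profile_iter_pos n x0).1).
have fbar0 : (0 <= fbar%:E)%E.
  by rewrite -fbarE; apply: integral_ge0 => x _; rewrite lee_fin.
rewrite -[LHS]addeA => E.
have F : ((expR s ^+ 2)%:E * laplace (profile_iter n).1
    + laplace (profile_iter n).2 + fhat%:E)%E \is a fin_num.
  by rewrite -(fineK IH1) -(fineK IH2).
by have [] := fin_num_summands krh (laplace_ge0 q2) (adde_ge0 C0 fbar0) F E.
Qed.

(* The weighted mass [W n := e^s * laplace G+ + laplace G-] of the iterates
   satisfies [(1 + e^s) (W n.+1 - W n) = fhat - fbar - (1 + e^s) C+(0)], and it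
   is non-decreasing in [n]. *)
Lemma profile_iter_bound n :
  (cumulative (profile_iter n).1 0%R + cumulative (profile_iter n).2 0%R <=
   ((fhat - fbar) / (1 + expR s))%:E)%E.
Proof.
have np := profile_iter_nonneg n; have [m1 m2 p1 p2] := np.
have [n1 n2 q1 q2] := profile_iter_nonneg n.+1.
have [le1 le2] := profile_iter_mono n.
have L1 := le_laplace m1 n1 p1 le1; have L2 := le_laplace m2 n2 p2 le2.
have := profile_step_laplace2 np (fun x x0 => (profile_iter_pos n x0).1).
have := profile_step_laplace1 np.
rewrite -/(profile_iter n.+1) rhE.
have [a1 b1] := profile_iter_laplace_fin n.
have [a2 b2] := profile_iter_laplace_fin n.+1.
move: L1 L2; rewrite -(fineK a1) -(fineK b1) -(fineK a2) -(fineK b2).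
move: (fine _) (fine _) (fine _) (fine _) => A' B' A B.
have C0 : (0 <= cumulative (profile_iter n).1 0%R
              + cumulative (profile_iter n).2 0%R)%E.
  by apply: adde_ge0; exact: cumulative_ge0.
move: (_ + _)%E C0 => C C0.
case: C C0 => [c _| |]//; rewrite !lee_fin.
rewrite -!EFinM -!EFinD => AA BB [E1] [E2].
have e0 := expR_gt0 s; rewrite ler_pdivlMr ?addr_gt0//.
(* Adding [e^s] times the first identity to the second makes both sides multiples of the same
   combination of transforms, [e^s] times the first plus the second; monotonicity then cancels
   it. *)
by nra.
Qed.

End Bound.

Definition profile_lim : (R -> \bar R) * (R -> \bar R) :=
  (fun x => limn (fun n => (profile_iter n).1 x),
   fun x => limn (fun n => (profile_iter n).2 x)).

Let profile_lim_cvg1 x : (profile_iter n).1 x @[n --> \oo] --> profile_lim.1 x.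
Proof.
apply: ereal_nondecreasing_is_cvgn; apply/nondecreasing_seqP => n.
by have [h _] := profile_iter_mono n; exact: h.
Qed.

Let profile_lim_cvg2 x : (profile_iter n).2 x @[n --> \oo] --> profile_lim.2 x.
Proof.
apply: ereal_nondecreasing_is_cvgn; apply/nondecreasing_seqP => n.
by have [_ h] := profile_iter_mono n; exact: h.
Qed.

Lemma profile_lim_nonneg : nonneg_measurable profile_lim.
Proof.
split.
- apply: (emeasurable_fun_cvg (fun n => (profile_iter n).1)) => //.
  by move=> n; have [] := profile_iter_nonneg n.
- apply: (emeasurable_fun_cvg (fun n => (profile_iter n).2)) => //.
  by move=> n; have [] := profile_iter_nonneg n.
- move=> x; apply: lime_ge; first by apply/cvg_ex; eexists; exact: profile_lim_cvg1.
  by apply: nearW => n; have [] := profile_iter_nonneg n.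
- move=> x; apply: lime_ge; first by apply/cvg_ex; eexists; exact: profile_lim_cvg2.
  by apply: nearW => n; have [] := profile_iter_nonneg n.
Qed.

Lemma profile_lim_pos x : 0 < x ->
  profile_lim.1 x = (gp x)%:E /\ profile_lim.2 x = (gm x)%:E.
Proof.
move=> x0; split => /=; apply: cvg_lim => //.
  under eq_fun do rewrite (profile_iter_pos _ x0).1; exact: cvg_cst.
under eq_fun do rewrite (profile_iter_pos _ x0).2; exact: cvg_cst.
Qed.

Let cumulative_lim1 x : cumulative (profile_iter n).1 x @[n --> \oo] -->
  cumulative profile_lim.1 x.
Proof.
apply: (@cumulative_limn R (fun n => (profile_iter n).1)).
- by move=> n; have [] := profile_iter_nonneg n.
- by move=> n; have [] := profile_iter_nonneg n.
- by move=> n; have [] := profile_iter_mono n.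
Qed.

Let cumulative_lim2 x : cumulative (profile_iter n).2 x @[n --> \oo] -->
  cumulative profile_lim.2 x.
Proof.
apply: (@cumulative_limn R (fun n => (profile_iter n).2)).
- by move=> n; have [] := profile_iter_nonneg n.
- by move=> n; have [] := profile_iter_nonneg n.
- by move=> n; have [] := profile_iter_mono n.
Qed.

Let cumulative_limD x y :
  (cumulative (profile_iter n).1 x + cumulative (profile_iter n).2 y)%E
    @[n --> \oo] --> (cumulative profile_lim.1 x + cumulative profile_lim.2 y)%E.
Proof.
have [_ _ p1 p2] := profile_lim_nonneg.
apply: cvgeD; [|exact: cumulative_lim1|exact: cumulative_lim2].
by apply: ge0_adde_def; rewrite inE; exact: cumulative_ge0.
Qed.

(** The shifted iterates have the same limit, and by monotone convergence they also converge to the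
    step applied to the limit. *)
Lemma profile_lim_fix1 x : x <= 0 ->
  (profile_lim.1 x = rh^-1%:E * (cumulative profile_lim.1 x + cumulative profile_lim.2 x))%E.
Proof.
move=> x0; apply: (@cvg_unique _ _ (fmap (fun n => (profile_iter n.+1).1 x) \oo)).
  exact: ereal_hausdorff.
  by have := @profile_lim_cvg1 x; rewrite -cvg_shiftS.
rewrite /= x0; apply: cvgeZl => //; exact: cumulative_limD.
Qed.

Lemma profile_lim_fix2 x : x <= 0 ->
  (profile_lim.2 x =
   rh^-1%:E * (cumulative profile_lim.1 (x + 1)%R + cumulative profile_lim.2 x))%E.
Proof.
move=> x0; apply: (@cvg_unique _ _ (fmap (fun n => (profile_iter n.+1).2 x) \oo)).
  exact: ereal_hausdorff.
  by have := @profile_lim_cvg2 x; rewrite -cvg_shiftS.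
rewrite /= x0; apply: cvgeZl => //; exact: cumulative_limD.
Qed.

Lemma profile_lim_bound (c : R) :
  (forall n, cumulative (profile_iter n).1 0%R + cumulative (profile_iter n).2 0%R
     <= c%:E)%E ->
  (cumulative profile_lim.1 0%R + cumulative profile_lim.2 0%R <= c%:E)%E.
Proof.
move=> h; have H := @cumulative_limD 0 0; rewrite -(cvg_lim _ H)//.
apply: lime_le; first by apply/cvg_ex; eexists; exact: H.
exact: nearW.
Qed.

End Iteration.

(** * The real-valued minimal profile and its regularity on the left *)

Section MinimalProfile.
Context {R : realType}.
Local Notation mu := (@lebesgue_measure R).
Implicit Types (Gp Gm gp gm : R -> R) (rh : R).

Lemma CplusE Gp Gm x : Cplus Gp Gm x =
  (cumulative (EFin \o Gp) x + cumulative (EFin \o Gm) x)%E.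
Proof. by []. Qed.

Lemma CminusE Gp Gm x : Cminus Gp Gm x =
  (cumulative (EFin \o Gp) (x + 1)%R + cumulative (EFin \o Gm) x)%E.
Proof. by []. Qed.

(** Robustness with equality on [x <= 0]: monotonicity, Lipschitz bounds and positivity there are
    then read off from integrals. *)
Definition left_balanced rh Gp Gm :=
  (forall x, x <= 0 -> Cplus Gp Gm x = (rh * Gp x)%:E) /\
  (forall x, x <= 0 -> Cminus Gp Gm x = (rh * Gm x)%:E).

(** The bound on [C+(0)] survives the limit and makes all relevant cumulative integrals finite. The
    fixed-point equations then make the limit itself finite at every point, so [fine] loses
    nothing. *)
Lemma minimal_profile_exists (s rh fhat fbar : R) gp gm :
  0 < s -> 2 * s * rh = 1 + expR s ->
  (forall x, 0 <= gp x) -> (forall x, 0 <= gm x) ->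
  measurable_fun setT gp -> measurable_fun setT gm ->
  (\int[mu]_(t in `]0%R, 1%R])
     ((expR (2 * s * (1 - t)))%:E * (gp t)%:E) = fhat%:E)%E ->
  (\int[mu]_(t in `]0%R, 1%R]) (gp t)%:E = fbar%:E)%E ->
  exists Gp Gm : R -> R,
    [/\ measurable_fun setT Gp, measurable_fun setT Gm,
        (forall x, 0 <= Gp x) & (forall x, 0 <= Gm x)] /\
    [/\ (forall x, 0 < x -> Gp x = gp x), (forall x, 0 < x -> Gm x = gm x),
        left_balanced rh Gp Gm &
        (Cplus Gp Gm 0 <= ((fhat - fbar) / (1 + expR s))%:E)%E].
Proof.
move=> s0 rhE gp0 gm0 mgp mgm fhatE fbarE.
have rh0 : 0 < rh.
  have : 0 < 2 * s * rh by rewrite rhE addr_gt0// expR_gt0.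
  by rewrite pmulr_rgt0// mulr_gt0.
pose P := profile_lim rh gp gm.
have [m1 m2 p1 p2] : nonneg_measurable P by exact: profile_lim_nonneg.
have pos x : 0 < x -> P.1 x = (gp x)%:E /\ P.2 x = (gm x)%:E.
  exact: profile_lim_pos.
have B : (cumulative P.1 0%R + cumulative P.2 0%R <=
    ((fhat - fbar) / (1 + expR s))%:E)%E.
  by apply: profile_lim_bound => // n; exact: profile_iter_bound.
have c1 : (cumulative P.1 0%R < +oo)%E.
  apply: (le_lt_trans _ (ltry ((fhat - fbar) / (1 + expR s)))).
  by apply: le_trans B; rewrite leeDl// cumulative_ge0.
have c2 : (cumulative P.2 0%R < +oo)%E.
  apply: (le_lt_trans _ (ltry ((fhat - fbar) / (1 + expR s)))).
  by apply: le_trans B; rewrite leeDr// cumulative_ge0.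
(* For [x <= 0] the integral of [G+] in [C-(x)] reaches as far as [1]. *)
have c3 : (cumulative P.1 1%R < +oo)%E.
  rewrite (cumulative_split m1 p1 ler01); apply: lte_add_pinfty => //.
  rewrite (_ : (\int[mu]_(t in _) _)%E = fbar%:E) ?ltry// -fbarE.
  apply: eq_integral => x; rewrite inE/= in_itv/= => /andP[x0 _].
  by have [] := pos x x0.
have fx1 x : x <= 0 -> (P.1 x = rh^-1%:E * (cumulative P.1 x + cumulative P.2 x))%E.
  exact: profile_lim_fix1.
have fx2 x : x <= 0 ->
    (P.2 x = rh^-1%:E * (cumulative P.1 (x + 1)%R + cumulative P.2 x))%E.
  exact: profile_lim_fix2.
have fin1 x : P.1 x \is a fin_num.
  have [x0|x0] := leP x 0; last by rewrite (pos x x0).1.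
  rewrite ge0_fin_numE// fx1//; apply: lte_mul_pinfty => //.
    by rewrite lee_fin invr_ge0 ltW.
  apply: lte_add_pinfty.
    by apply: le_lt_trans c1; exact: le_cumulative.
  by apply: le_lt_trans c2; exact: le_cumulative.
have fin2 x : P.2 x \is a fin_num.
  have [x0|x0] := leP x 0; last by rewrite (pos x x0).2.
  rewrite ge0_fin_numE// fx2//; apply: lte_mul_pinfty => //.
    by rewrite lee_fin invr_ge0 ltW.
  apply: lte_add_pinfty.
    by apply: le_lt_trans c3; apply: le_cumulative => //; rewrite gerDr.
  by apply: le_lt_trans c2; exact: le_cumulative.
have E1 : EFin \o (fine \o P.1) = P.1.
  by apply/funext => x; exact: fineK (fin1 x).
have E2 : EFin \o (fine \o P.2) = P.2.
  by apply/funext => x; exact: fineK (fin2 x).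
exists (fine \o P.1), (fine \o P.2); split.
  split.
  - by apply: measurableT_comp => //; exact: measurable_fine.
  - by apply: measurableT_comp => //; exact: measurable_fine.
  - by move=> x; rewrite compE fine_ge0.
  - by move=> x; rewrite compE fine_ge0.
rewrite /left_balanced; split.
- by move=> x x0; rewrite compE (pos x x0).1.
- by move=> x x0; rewrite compE (pos x x0).2.
- split => x x0; rewrite ?CplusE ?CminusE E1 E2 EFinM compE fineK//.
    by rewrite [in RHS]fx1// muleA -EFinM divff ?mul1e// gt_eqF.
  by rewrite [in RHS]fx2// muleA -EFinM divff ?mul1e// gt_eqF.
- by rewrite CplusE E1 E2.
Qed.

Lemma integral_oc_cst (c a b : R) : a <= b ->
  (\int[mu]_(t in `]a, b]) c%:E = (c * (b - a))%:E)%E.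
Proof.
move=> ab; rewrite integral_cst//= lebesgue_measure_itv/= lte_fin.
case: ifPn => [_|]; first by rewrite -EFinB -EFinM.
rewrite -leNgt => ba; have -> : a = b by apply/le_anti/andP.
by rewrite subrr mulr0 mule0.
Qed.

Lemma cumulative_le_slope (G : R -> R) (M a b : R) :
  measurable_fun setT G -> (forall x, 0 <= G x) -> a <= b ->
  (forall t, a < t -> t <= b -> G t <= M) ->
  (cumulative (EFin \o G) b <= cumulative (EFin \o G) a + (M * (b - a))%:E)%E.
Proof.
move=> mG G0 ab GM.
have mE : measurable_fun setT (EFin \o G) by exact/measurable_EFinP.
rewrite (cumulative_split mE _ ab); last by move=> t; rewrite lee_fin.
rewrite leeD2l// -integral_oc_cst//; apply: ge0_le_integral => //.
- by move=> t _; rewrite lee_fin.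
- exact: measurable_funTS.
- by move=> t /=; rewrite in_itv/= lee_fin => /andP[at_ tb]; exact: GM.
Qed.

Lemma cumulative_ge_slope (G : R -> R) (m a b : R) :
  measurable_fun setT G -> (forall x, 0 <= G x) -> a <= b -> 0 <= m ->
  (forall t, a < t -> t <= b -> m <= G t) ->
  (cumulative (EFin \o G) a + (m * (b - a))%:E <= cumulative (EFin \o G) b)%E.
Proof.
move=> mG G0 ab m0 GM.
have mE : measurable_fun setT (EFin \o G) by exact/measurable_EFinP.
rewrite (cumulative_split mE _ ab); last by move=> t; rewrite lee_fin.
rewrite leeD2l// -integral_oc_cst//; apply: ge0_le_integral => //.
- exact: measurable_funTS.
- by move=> t /=; rewrite in_itv/= lee_fin => /andP[at_ tb]; exact: GM.
Qed.

(** * Monotonicity, Lipschitz bounds and positivity from the balance equations *)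

Section Balanced.
Variables (rh : R) (Gp Gm : R -> R).
Hypothesis rh0 : 0 < rh.
Hypothesis mGp : measurable_fun setT Gp.
Hypothesis mGm : measurable_fun setT Gm.
Hypothesis Gp0 : forall x, 0 <= Gp x.
Hypothesis Gm0 : forall x, 0 <= Gm x.
Hypothesis bal : left_balanced rh Gp Gm.

Let mEGp : measurable_fun setT (EFin \o Gp). Proof. exact/measurable_EFinP. Qed.
Let mEGm : measurable_fun setT (EFin \o Gm). Proof. exact/measurable_EFinP. Qed.
Let EGp0 x : (0 <= (EFin \o Gp) x)%E. Proof. by rewrite lee_fin. Qed.
Let EGm0 x : (0 <= (EFin \o Gm) x)%E. Proof. by rewrite lee_fin. Qed.

Lemma le_Cplus x y : x <= y -> (Cplus Gp Gm x <= Cplus Gp Gm y)%E.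
Proof. by move=> xy; rewrite !CplusE leeD// le_cumulative. Qed.

Lemma le_Cminus x y : x <= y -> (Cminus Gp Gm x <= Cminus Gp Gm y)%E.
Proof. by move=> xy; rewrite !CminusE leeD// le_cumulative// lerD2r. Qed.

Lemma balanced_le x y : x <= y -> y <= 0 -> Gp x <= Gp y /\ Gm x <= Gm y.
Proof.
move=> xy y0; have x0 := le_trans xy y0; have [b1 b2] := bal; split.
  by have := le_Cplus xy; rewrite !b1// lee_fin ler_pM2l.
by have := le_Cminus xy; rewrite !b2// lee_fin ler_pM2l.
Qed.

(** The increment of [C+] integrates [G+] and [G-] over []x, y]], each at most [M]. This Lipschitz
    bound is the source of left-continuity. *)
Lemma balanced_slope1 (M x y : R) : x <= y -> y <= 0 ->
  (forall t, t <= 0 -> Gp t <= M) -> (forall t, t <= 0 -> Gm t <= M) ->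
  rh * Gp y <= rh * Gp x + 2 * M * (y - x).
Proof.
move=> xy y0 hp hm; have x0 := le_trans xy y0; have [b1 b2] := bal.
rewrite -lee_fin EFinD -!b1// !CplusE.
have -> : 2 * M * (y - x) = M * (y - x) + M * (y - x) by ring.
rewrite EFinD [leRHS]addeACA; apply: leeD; apply: cumulative_le_slope => // t _ ty.
  by apply: hp; exact: le_trans y0.
by apply: hm; exact: le_trans y0.
Qed.

(** As for [balanced_slope1], but [G+] is integrated over a window shifted by one, hence must be
    bounded up to [1]. *)
Lemma balanced_slope2 (M x y : R) : x <= y -> y <= 0 ->
  (forall t, t <= 1 -> Gp t <= M) -> (forall t, t <= 0 -> Gm t <= M) ->
  rh * Gm y <= rh * Gm x + 2 * M * (y - x).
Proof.
move=> xy y0 hp hm; have x0 := le_trans xy y0; have [b1 b2] := bal.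
rewrite -lee_fin EFinD -!b2// !CminusE.
have -> : 2 * M * (y - x) = M * (y + 1 - (x + 1)) + M * (y - x) by ring.
rewrite EFinD [leRHS]addeACA; apply: leeD; apply: cumulative_le_slope => //.
- by rewrite lerD2r.
- by move=> t _ ty; apply: hp; apply: (le_trans ty); rewrite gerDr.
by move=> t _ ty; apply: hm; exact: le_trans y0.
Qed.

(** Positivity spreads leftwards one unit at a time. Since [C-(y)] sees [G+] up to [y + 1],
    positivity beyond [-n] gives [G- > 0] beyond [-n - 1]; then [C+] sees this [G-] and passes
    positivity on to [G+]. *)
Lemma balanced_pos : (forall x, 0 < x -> 1 <= Gp x) -> (forall x, 0 < x -> 0 < Gm x) ->
  forall x, 0 < Gp x /\ 0 < Gm x.
Proof.
move=> gp1 gm1; have [b1 b2] := bal.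
have H n : forall x, - n%:R < x -> 0 < Gp x /\ 0 < Gm x.
  elim: n => [|n IH] x.
    by rewrite oppr0 => x0; split; [exact: lt_le_trans (gp1 x x0)|exact: gm1].
  rewrite -natr1 opprD => nx.
  have [x0|x0] := ltP 0 x.
    by split; [exact: lt_le_trans (gp1 x x0)|exact: gm1].
  have Gmp y : - n%:R - 1 < y -> y <= 0 -> 0 < Gm y.
    (* The midpoint of [-n] and [y + 1], where the induction hypothesis applies. *)
    move=> ny y0; pose a : R := (y + 1 - n%:R) / 2.
    have [Gpa _] : 0 < Gp a /\ 0 < Gm a by apply: IH; rewrite /a; lra.
    have ay : a < y + 1 by rewrite /a; lra.
    (* The interval []a, y + 1]] may cross [0], and monotonicity is so far available only on
       [x <= 0]; to the right the lower bound is [1]. *)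
    pose m := Num.min (Gp a) 1.
    have m0 : 0 < m by rewrite lt_min Gpa ltr01.
    have := @cumulative_ge_slope Gp m a (y + 1) mGp Gp0 (ltW ay) (ltW m0).
    have tm t : a < t -> t <= y + 1 -> m <= Gp t.
      move=> at_ _; have [t0|t0] := ltP 0 t.
        by apply: le_trans (gp1 _ t0); rewrite ge_min lexx orbT.
      by rewrite ge_min; apply/orP; left; exact: (balanced_le (ltW at_) t0).1.
    move=> /(_ tm) C.
    have : (0 < (rh * Gm y)%:E)%E.
      rewrite -b2// CminusE; apply: lt_le_trans (leeDl _ (cumulative_ge0 _ EGm0)).
      apply: lt_le_trans C; apply: lt_le_trans (leeDr _ (cumulative_ge0 _ EGp0)).
      by rewrite lte_fin mulr_gt0// subr_gt0.
    by rewrite lte_fin pmulr_rgt0.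
  split; last exact: Gmp.
  (* The midpoint of [-n - 1] and [x], where [G- > 0] has just been shown. *)
  pose a : R := (x - n%:R - 1) / 2.
  have ax : a < x by rewrite /a; lra.
  have na : - n%:R - 1 < a by rewrite /a; lra.
  have a0 : a <= 0 := le_trans (ltW ax) x0.
  have Gma := Gmp a na a0.
  have := @cumulative_ge_slope Gm (Gm a) a x mGm Gm0 (ltW ax) (ltW Gma).
  have tm t : a < t -> t <= x -> Gm a <= Gm t.
    by move=> at_ tx; exact: (balanced_le (ltW at_) (le_trans tx x0)).2.
  move=> /(_ tm) C.
  have : (0 < (rh * Gp x)%:E)%E.
    rewrite -b1// CplusE; apply: lt_le_trans (leeDr _ (cumulative_ge0 _ EGp0)).
    apply: lt_le_trans C; apply: lt_le_trans (leeDr _ (cumulative_ge0 _ EGm0)).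
    by rewrite lte_fin mulr_gt0// subr_gt0.
  by rewrite lte_fin pmulr_rgt0.
move=> x; apply: (H (Num.truncn `|x|).+1).
have := truncnS_gt `|x|; have := ler_norm (- x); rewrite normrN; lra.
Qed.

End Balanced.

End MinimalProfile.

(** * Exponential tails on [x > 0] and assembly of the profile *)

Section ExponentialContinuation.
Context {R : realType}.
Local Notation mu := (@lebesgue_measure R).

Lemma cvg_at_left_slope (G : R -> R) (x L : R) :
  (forall t, t <= x -> G t <= G x) ->
  (forall t, t <= x -> G x <= G t + L * (x - t)) ->
  G t @[t --> x^'-] --> G x.
Proof.
move=> h1 h2.
apply: (@squeeze_cvgr _ _ _ _ (fun t => G x - L * (x - t)) (fun=> G x)).
- near=> t; have tx : t <= x by apply/ltW; near: t; exact: nbhs_left_lt.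
  by rewrite h1// andbT lerBlDr h2.
- have -> : nbhs (G x) = nbhs (G x - L * (x - x)) by rewrite subrr mulr0 subr0.
  apply: cvg_at_left_filter; apply: cvgB; first exact: cvg_cst.
  apply: cvgMr; apply: cvgB; [exact: cvg_cst|exact: cvg_id].
- exact: cvg_cst.
Unshelve. all: by end_near. Qed.

Lemma cvg_at_left_pos (G g : R -> R) (x : R) : 0 < x -> continuous g ->
  (forall t, 0 < t -> G t = g t) -> G t @[t --> x^'-] --> G x.
Proof.
move=> x0 cg Gg; rewrite (Gg _ x0).
have : g t @[t --> x^'-] --> g x by exact: cvg_at_left_filter (cg x).
apply: cvg_trans; apply: near_eq_cvg; near=> t.
by rewrite Gg//; near: t; exact: nbhs_left_gt.
Unshelve. all: by end_near. Qed.

Lemma continuous_max1 (g : R -> R) : continuous g ->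
  continuous (fun t => Num.max 1 (g t)).
Proof. by move=> cg x; apply: continuous_max => //; [exact: cvg_cst|exact: cg]. Qed.

Section Tails.
Variables (s K : R).
Hypothesis s0 : 0 < s.
Hypothesis K1 : 1 <= K.
Hypothesis Kle : K <= expR (2 * s).

(** Normalised so that [a * e^(2st)] equals [K] at [t = 1]; it crosses the value [1] at [x0], and
    [1 <= K <= e^(2s)] places [x0] in [[0, 1]]. *)
Let a := K / expR (2 * s).
Let x0 := 1 - ln K / (2 * s).
Let K0 : 0 < K := lt_le_trans ltr01 K1.
Let s20 : 0 < 2 * s. Proof. by rewrite mulr_gt0. Qed.

(** The ratio [e^s] between the minus and plus exponentials is forced: [e^(2st)] and [e^s * e^(2st)]
    on the whole line satisfy both robustness conditions with equality for [rho s]. *)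
Definition plus_tail (t : R) := Num.max 1 (a * expR (2 * s * t)).
Definition minus_tail (t : R) := a * expR s * expR (2 * s * t).

Let a_gt0 : 0 < a. Proof. by rewrite divr_gt0// expR_gt0. Qed.
Let a_le1 : a <= 1. Proof. by rewrite ler_pdivrMr ?expR_gt0// mul1r. Qed.

Let lnK_ge0 : 0 <= ln K. Proof. exact: ln_ge0. Qed.
Let lnK_le : ln K <= 2 * s.
Proof. by rewrite -[leRHS]expRK ler_ln ?posrE// expR_gt0. Qed.

Let x0E : 2 * s * x0 = 2 * s - ln K.
Proof. by rewrite /x0; field; rewrite gt_eqF. Qed.

Let x0_ge0 : 0 <= x0. Proof. by rewrite subr_ge0 ler_pdivrMr// mul1r. Qed.
Let x0_le1 : x0 <= 1. Proof. by rewrite gerBl divr_ge0// ltW. Qed.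

Let a_x0 : a * expR (2 * s * x0) = 1.
Proof.
rewrite x0E expRB lnK ?posrE// /a; field.
by rewrite !gt_eqF ?expR_gt0.
Qed.

Let plus_tail_lo t : t <= x0 -> plus_tail t = 1.
Proof.
move=> tx; apply/max_idPl; rewrite -[leRHS]a_x0.
by rewrite ler_pM2l// ler_expR ler_pM2l.
Qed.

Let plus_tail_hi t : x0 <= t -> plus_tail t = a * expR (2 * s * t).
Proof.
move=> tx; apply/max_idPr; rewrite -[leLHS]a_x0.
by rewrite ler_pM2l// ler_expR ler_pM2l.
Qed.

Let plus_tail_ge1 t : 1 <= plus_tail t. Proof. by rewrite le_max lexx. Qed.
Let plus_tail_ge0 t : 0 <= plus_tail t. Proof. exact: le_trans (plus_tail_ge1 t). Qed.
Let minus_tail_gt0 t : 0 < minus_tail t.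
Proof. exact: mulr_gt0 (mulr_gt0 a_gt0 (expR_gt0 _)) (expR_gt0 _). Qed.

Let continuous_plus_tail : continuous plus_tail.
Proof. by apply: continuous_max1; exact: continuous_expR_scale. Qed.

Let continuous_minus_tail : continuous minus_tail.
Proof. exact: continuous_expR_scale. Qed.

Let measurable_plus_tail : measurable_fun setT plus_tail.
Proof. exact: continuous_measurable_fun. Qed.

Let measurable_minus_tail : measurable_fun setT minus_tail.
Proof. exact: continuous_measurable_fun. Qed.

Lemma integral_plus_tail x : x0 <= x ->
  (\int[mu]_(t in `]0%R, x]) (plus_tail t)%:E =
   (x0 + (a * expR (2 * s * x) - 1) / (2 * s))%:E)%E.
Proof.
move=> x0x; rewrite (integral_oc_split _ _ x0_ge0 x0x); last 2 first.
- exact/measurable_EFinP.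
- by move=> t _; rewrite lee_fin.
have -> : (\int[mu]_(t in `]0%R, x0]) (plus_tail t)%:E = x0%:E)%E.
  transitivity (\int[mu]_(t in `]0%R, x0]) 1%:E)%E.
    apply: eq_integral => t; rewrite inE/= in_itv/= => /andP[_ tx].
    by rewrite plus_tail_lo.
  by rewrite integral_oc_cst// subr0 mul1r.
have -> : (\int[mu]_(t in `]x0, x]) (plus_tail t)%:E =
    ((a * expR (2 * s * x) - 1) / (2 * s))%:E)%E.
  transitivity (\int[mu]_(t in `]x0, x]) (a * expR (2 * s * t))%:E)%E.
    apply: eq_integral => t; rewrite inE/= in_itv/= => /andP[tx _].
    by rewrite plus_tail_hi// ltW.
  rewrite integral_expR_scale ?gt_eqF//; congr (_%:E).
  by rewrite mulrAC mulrBr a_x0.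
by [].
Qed.

Lemma integral_minus_tail x : 0 <= x ->
  (\int[mu]_(t in `]0%R, x]) (minus_tail t)%:E =
   (a * expR s / (2 * s) * (expR (2 * s * x) - 1))%:E)%E.
Proof.
by move=> x_ge0; rewrite integral_expR_scale ?gt_eqF// mulr0 expR0.
Qed.

(** Up to [x0] the tail is [1] and the pure weight is integrated; beyond [x0] weight and tail
    multiply to the constant [K], over a length [ln K / (2s)]. *)
Lemma integral_plus_tail_weight :
  (\int[mu]_(t in `]0%R, 1%R])
     ((expR (2 * s * (1 - t)))%:E * (plus_tail t)%:E) =
   ((expR (2 * s) - K + K * ln K) / (2 * s))%:E)%E.
Proof.
rewrite (integral_oc_split _ _ x0_ge0 x0_le1); last 2 first.
- apply: emeasurable_funM; last exact/measurable_EFinP.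
  apply/measurable_EFinP; apply: measurableT_comp; first exact: measurable_expR.
  by apply: measurable_funM => //; exact: measurable_funB.
- by move=> t _; rewrite mule_ge0// lee_fin ?expR_ge0.
have -> : (\int[mu]_(t in `]0%R, x0])
     ((expR (2 * s * (1 - t)))%:E * (plus_tail t)%:E) =
    ((expR (2 * s) - K) / (2 * s))%:E)%E.
  transitivity (\int[mu]_(t in `]0%R, x0])
      (expR (2 * s) * expR (- (2 * s) * t))%:E)%E.
    apply: eq_integral => t; rewrite inE/= in_itv/= => /andP[_ tx].
    rewrite plus_tail_lo// mule1 -expRD; congr ((expR _)%:E); ring.
  rewrite integral_expR_scale//; last by rewrite oppr_eq0 gt_eqF.
  congr (_%:E); rewrite mulr0 expR0 mulNr expRN x0E expRB lnK ?posrE//.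
  by field; rewrite !gt_eqF ?expR_gt0.
have -> : (\int[mu]_(t in `]x0, 1%R])
     ((expR (2 * s * (1 - t)))%:E * (plus_tail t)%:E) =
    (K * ln K / (2 * s))%:E)%E.
  transitivity (\int[mu]_(t in `]x0, 1%R]) K%:E)%E.
    apply: eq_integral => t; rewrite inE/= in_itv/= => /andP[tx _].
    rewrite plus_tail_hi ?ltW// -EFinM; congr (_%:E).
    rewrite mulrCA -expRD (_ : _ + _ = 2 * s); last by ring.
    by rewrite /a mulfVK// gt_eqF// expR_gt0.
  rewrite integral_oc_cst//; congr (_%:E).
  by rewrite /x0; field; rewrite gt_eqF.
by rewrite -EFinD -mulrDl.
Qed.

(** The equation for [ch] says that it is the bound on [C+(0)] from [minimal_profile_exists]. The
    inequality is [C-(0) <= rho G-(0+)] with [C+(0)] replaced by [ch] and cleared of denominators;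
    it controls robustness on all of [x > 0]. *)
Lemma excursion_profile_tails (ch : R) :
  ch = (expR (2 * s) + 1 + (1 + K) * ln K - 2 * K - 2 * s)
         / (2 * s * (1 + expR s)) ->
  2 * s * ch <= K * expR (- s) - 2 * s + ln K + 1 ->
  exists Gp Gm : R -> R, excursion_profile (rho s) ch Gp Gm.
Proof.
move=> chE key.
have q0 : 0 < expR s := expR_gt0 s.
have qq : expR (2 * s) = expR s * expR s by rewrite -expRD; congr expR; ring.
have aK : a * (expR s * expR s) = K by rewrite /a qq mulfVK// mulf_neq0 ?gt_eqF.
have aq : K * expR (- s) = a * expR s.
  by rewrite expRN -aK; field; rewrite gt_eqF.
have rhE : 2 * s * rho s = 1 + expR s by rewrite /rho; field; rewrite gt_eqF.
have rh0 : 0 < rho s by rewrite divr_gt0// addr_gt0.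
have fbarE := integral_plus_tail x0_le1.
have aex1 : a * expR (2 * s * 1) = K by rewrite mulr1 qq.
have [Gp [Gm [[mGp mGm Gp0 Gm0] [Gpp Gmp bal B]]]] := minimal_profile_exists s0 rhE
  plus_tail_ge0 (fun t => ltW (minus_tail_gt0 t)) measurable_plus_tail
  measurable_minus_tail integral_plus_tail_weight fbarE.
have {}B : (Cplus Gp Gm 0 <= ch%:E)%E.
  rewrite (_ : ch = ((expR (2 * s) - K + K * ln K) / (2 * s) -
    (x0 + (a * expR (2 * s * 1) - 1) / (2 * s))) / (1 + expR s))//.
  rewrite chE aex1 /x0; field; rewrite !gt_eqF ?addr_gt0//.
have [b1 b2] := bal.
(* Besides being part of the definition of a profile, this gives [G+(0) <= 1], hence monotonicity of
   [G+] across [0]. *)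
have ch_rh : ch <= rho s.
  rewrite -(ler_pM2l s20) rhE; apply: (le_trans key); rewrite aq.
  have : a * expR s <= expR s by rewrite ler_piMl// ltW.
  by move: lnK_le; lra.
have rGp0 : rho s * Gp 0 <= ch by rewrite -lee_fin -b1.
have Gp0_le1 : Gp 0 <= 1.
  by rewrite -(ler_pM2l rh0) mulr1; exact: le_trans ch_rh.
have mEGp : measurable_fun setT (EFin \o Gp) by exact/measurable_EFinP.
have mEGm : measurable_fun setT (EFin \o Gm) by exact/measurable_EFinP.
have EGp0 x : (0 <= (EFin \o Gp) x)%E by rewrite lee_fin.
have EGm0 x : (0 <= (EFin \o Gm) x)%E by rewrite lee_fin.
have cumGp x : x0 <= x -> (cumulative (EFin \o Gp) x = cumulative (EFin \o Gp) 0%R +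
    (x0 + (a * expR (2 * s * x) - 1) / (2 * s))%:E)%E.
  move=> xx; rewrite (cumulative_split mEGp EGp0 (le_trans x0_ge0 xx)).
  congr (_ + _)%E; rewrite -integral_plus_tail//; apply: eq_integral => t.
  by rewrite inE/= in_itv/= => /andP[t0 _]; rewrite Gpp.
have cumGm x : 0 <= x -> (cumulative (EFin \o Gm) x = cumulative (EFin \o Gm) 0%R +
    (a * expR s / (2 * s) * (expR (2 * s * x) - 1))%:E)%E.
  move=> xx; rewrite (cumulative_split mEGm EGm0 xx).
  congr (_ + _)%E; rewrite -integral_minus_tail//; apply: eq_integral => t.
  by rewrite inE/= in_itv/= => /andP[t0 _]; rewrite Gmp.
have gm_mono x y : x <= y -> minus_tail x <= minus_tail y.
  by move=> xy; rewrite /minus_tail (ler_pM2l (mulr_gt0 a_gt0 q0)) ler_expR ler_pM2l.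
have gp_mono x y : x <= y -> plus_tail x <= plus_tail y.
  move=> xy; rewrite /plus_tail ge_max !le_max lexx/=; apply/orP; right.
  by rewrite ler_pM2l// ler_expR ler_pM2l.
(* The terms growing like [e^(2sx)] agree on both sides, so the inequality at every [x] collapses to
   [key]. *)
have Cm x : 0 <= x -> (Cminus Gp Gm x <= (rho s * minus_tail x)%:E)%E.
  move=> x_ge0; rewrite CminusE cumGm// cumGp; last first.
    by apply: (le_trans x0_le1); rewrite lerDr.
  rewrite [leLHS]addeACA -CplusE -EFinD.
  apply: (le_trans (leeD2r _ B)); rewrite -EFinD lee_fin.
  rewrite /minus_tail mulrDr mulr1 expRD.
  rewrite -(ler_pM2l s20) [leRHS]mulrA rhE.
  move: (expR (2 * s * x)) => e.
  rewrite (_ : 2 * s * _ = 2 * s * ch + 2 * s * x0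
    + (a * (expR s * expR s) * e - 1) + a * expR s * (e - 1)); last first.
    by rewrite qq; field; rewrite gt_eqF.
  by move: key; rewrite aq x0E; lra.
(* From [x0] on, where the plus tail is a pure exponential, the same cancellation leaves [key]
   again. *)
have Cp x : x0 <= x -> (Cplus Gp Gm x <= (rho s * (a * expR (2 * s * x)))%:E)%E.
  move=> xx; rewrite CplusE cumGm ?(le_trans x0_ge0)// cumGp//.
  rewrite [leLHS]addeACA -CplusE -EFinD.
  apply: (le_trans (leeD2r _ B)); rewrite -EFinD lee_fin.
  rewrite -(ler_pM2l s20) [leRHS]mulrA rhE.
  move: (expR (2 * s * x)) => e.
  rewrite (_ : 2 * s * _ = 2 * s * ch + 2 * s * x0
    + (a * e - 1) + a * expR s * (e - 1)); last by field; rewrite gt_eqF.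
  by move: key; rewrite aq x0E; lra.
have Gm0_le : Gm 0 <= minus_tail 0.
  by rewrite -(ler_pM2l rh0) -lee_fin -b2//; exact: Cm.
have bmono := balanced_le rh0 mGp mGm Gp0 Gm0 bal.
have [Gp_gt0 Gm_gt0] : (forall x, 0 < Gp x) /\ (forall x, 0 < Gm x).
  have gp1 x : 0 < x -> 1 <= Gp x by move=> x_gt0; rewrite Gpp// plus_tail_ge1.
  have gm1 x : 0 < x -> 0 < Gm x by move=> x_gt0; rewrite Gmp// minus_tail_gt0.
  by split=> x; have [] := balanced_pos rh0 mGp mGm Gp0 Gm0 bal gp1 gm1 x.
have Gp_mono : {homo Gp : x y / x <= y}.
  move=> x y xy; have [y0|y0] := leP y 0; first exact: (bmono x y xy y0).1.
  have [xle0|x_gt0] := leP x 0; last by rewrite !Gpp// gp_mono.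
  rewrite (Gpp y)//; apply: le_trans (plus_tail_ge1 y).
  exact: le_trans (bmono x 0 xle0 (lexx 0)).1 Gp0_le1.
have Gm_mono : {homo Gm : x y / x <= y}.
  move=> x y xy; have [y0|y0] := leP y 0; first exact: (bmono x y xy y0).2.
  have [xle0|x_gt0] := leP x 0; last by rewrite !Gmp// gm_mono.
  rewrite (Gmp y)//; apply: le_trans (gm_mono 0 y (ltW y0)).
  exact: le_trans (bmono x 0 xle0 (lexx 0)).2 Gm0_le.
(* A common bound for [G+] up to [1] and [G-] up to [0], as the Lipschitz estimates require. *)
pose M := Gp 1 + Gm 0.
have Mp t : t <= 1 -> Gp t <= M by move=> t1; rewrite ler_wpDr// Gp_mono.
have Mm t : t <= 0 -> Gm t <= M by move=> t0; rewrite ler_wpDl// Gm_mono.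
have Gp_left x : Gp t @[t --> x^'-] --> Gp x.
  have [xle0|x_gt0] := leP x 0; last first.
    exact: (cvg_at_left_pos x_gt0 continuous_plus_tail).
  apply: (@cvg_at_left_slope _ _ (2 * M / rho s)) => t tx; first exact: Gp_mono.
  rewrite -(ler_pM2l rh0) mulrDr.
  apply: (le_trans (balanced_slope1 mGp mGm Gp0 Gm0 bal tx xle0 (M := M) _ _)).
  - by move=> u u0; apply: Mp; exact: le_trans ler01.
  - exact: Mm.
  by rewrite lerD2l le_eqVlt; apply/orP; left; apply/eqP; field; rewrite gt_eqF.
have Gm_left x : Gm t @[t --> x^'-] --> Gm x.
  have [xle0|x_gt0] := leP x 0; last first.
    exact: (cvg_at_left_pos x_gt0 continuous_minus_tail).
  apply: (@cvg_at_left_slope _ _ (2 * M / rho s)) => t tx; first exact: Gm_mono.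
  rewrite -(ler_pM2l rh0) mulrDr.
  apply: (le_trans (balanced_slope2 mGp mGm Gp0 Gm0 bal tx xle0 (M := M) Mp Mm)).
  by rewrite lerD2l le_eqVlt; apply/orP; left; apply/eqP; field; rewrite gt_eqF.
exists Gp, Gm; split => //.
- by split=> //; apply: lt_le_trans rGp0; rewrite mulr_gt0.
- split => x xn; first by rewrite Gpp// plus_tail_ge1.
  (* Strictness: [G+ >= G+(x) > 0] on []x, 0]], so [C+(x) < C+(0)] and balance gives
     [G+(x) < G+(0)]. *)
  apply: (lt_le_trans _ Gp0_le1).
  have slope := cumulative_ge_slope mGp Gp0 (ltW xn) (Gp0 x)
    (fun t xt _ => Gp_mono x t (ltW xt)).
  have : (Cplus Gp Gm x + (Gp x * (0 - x))%:E <= Cplus Gp Gm 0)%E.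
    rewrite !CplusE addeAC; apply: leeD slope _.
    by apply: le_cumulative => //; exact: ltW.
  rewrite (b1 x (ltW xn)) (b1 0 (lexx 0)) -EFinD lee_fin -(ltr_pM2l rh0); apply: lt_le_trans.
  by rewrite ltrDl mulr_gt0// sub0r oppr_gt0.
- move=> x; have [xle0|x_gt0] := leP x 0; first by rewrite b1// b2.
  rewrite Gpp// Gmp//; split; last exact: Cm (ltW x_gt0).
  (* Below [x0] the tail is at least [1] and [C+(x) <= C+(x0) <= rho]. *)
  have [xx|xx] := leP x0 x; first by rewrite plus_tail_hi// Cp.
  apply: (le_trans (le_Cplus mGp mGm Gp0 Gm0 (ltW xx))).
  apply: (le_trans (Cp x0 (lexx x0))).
  by rewrite a_x0 lee_fin ler_pM2l// plus_tail_ge1.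
Qed.

End Tails.
End ExponentialContinuation.

(** * The constants [s_star], [s_K] and the root [xi] *)

Section SpecialValues.
Context {R : realType}.
Implicit Types s t x : R.

(** With [w = W_0(e^(-1))] this is [w e^w = e^(-1)] multiplied by [e]. A root in [[0, 1]] from the
    intermediate value theorem ensures that [xget] does not return its default. *)
Lemma s_starE : (s_star R - 1) * expR (s_star R) = 1.
Proof.
have [c] : exists2 c : R, c \in `[0, 1] & c * expR c = expR (-1).
  apply: (@IVT R (fun w => w * expR w)) => //.
  - apply: continuous_subspaceT => w; apply: cvgM; first exact: cvg_id.
    exact: continuous_expR.
  - rewrite mul0r mul1r ge_min expR_ge0/= le_max; apply/orP; right.
    by rewrite ler_expR; lra.
rewrite in_itv/= => /andP[c0 _] cE.
have [_ WE] : [set w : R | -1 <= w /\ w * expR w = expR (-1)] (LambertW0 (expR (-1))).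
  by apply: xgetPex; exists c; split => //; apply: le_trans c0; lra.
rewrite /s_star addrAC subrr add0r expRD mulrCA WE -expRD.
by rewrite subrr expR0.
Qed.

(** This is [(s - 1) e^s <= 1], with equality at [s_star]; it is the form in which [s <= s_star]
    enters the analysis of [xi]. *)
Lemma mulr_expR_s_star s : s <= s_star R -> s * expR s <= 1 + expR s.
Proof.
move=> ss; have e : expR s <= expR (s_star R) by rewrite ler_expR.
have q0 := expR_gt0 s; have E := s_starE; have Q0 := expR_gt0 (s_star R).
have t0 : 0 < s_star R - 1 by rewrite -(pmulr_lgt0 _ Q0) E.
have := ler_wpM2r (ltW q0) ss; have := ler_wpM2l (ltW t0) e.
by lra.
Qed.

(** The left side increases in the variable and the right side decreases. *)
Lemma K_threshold_mono s t : 0 < s -> s <= t ->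
  expR t * (expR t + 2 * t - 1) <= 3 + expR (- t) ->
  expR s * (expR s + 2 * s - 1) <= 3 + expR (- s).
Proof.
move=> s0 st h.
have e1 : expR s <= expR t by rewrite ler_expR.
have e2 : expR (- t) <= expR (- s) by rewrite ler_expR lerN2.
have e3 := expR_gt0 s; have e4 : 1 + s <= expR s := expR_ge1Dx s.
suff : expR s * (expR s + 2 * s - 1) <= expR t * (expR t + 2 * t - 1) by lra.
by apply: ler_pM; lra.
Qed.

(** Relates the equation defining [s_K] to the equation for [xi] at [x = 1], where the logarithm
    vanishes: [s_K] is the threshold at which [1] solves the latter. *)
Lemma s_K_equivE s :
  expR s * (expR (2 * s) - 1 + 2 * s * expR s) - (1 + expR s) ^+ 2 =
  expR s * (expR s * (expR s + 2 * s - 1) - (3 + expR (- s))).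
Proof.
have -> : expR (2 * s) = expR s * expR s by rewrite -expRD; congr expR; ring.
by rewrite expRN; field; rewrite gt_eqF// expR_gt0.
Qed.

Lemma s_KE : 0 < s_K R /\
  expR (s_K R) * (expR (s_K R) + 2 * s_K R - 1) = 3 + expR (- s_K R).
Proof.
have [c] : exists2 c : R, c \in `[0, 1] &
    expR c * (expR c + 2 * c - 1) - (3 + expR (- c)) = 0.
  apply: (@IVT R (fun c => expR c * (expR c + 2 * c - 1) - (3 + expR (- c)))) => //.
  - apply: continuous_subspaceT => c.
    have eN : expR (- t) @[t --> c] --> expR (- c).
      by apply: continuous_comp; [exact: continuousN cvg_id|exact: continuous_expR].
    apply: cvgB; last by apply: cvgD; [exact: cvg_cst|exact: eN].
    apply: cvgM; first exact: continuous_expR.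
    apply: cvgB; last exact: cvg_cst.
    apply: cvgD; first exact: continuous_expR.
    by apply: cvgMr; exact: cvg_id.
  - rewrite /= !oppr0 !expR0; have := expR_ge1Dx (1 : R).
    have e1 : expR (- 1) <= 1 :> R by rewrite expR_le1; lra.
    move=> e2; rewrite ge_min le_max; apply/andP; split; apply/orP; [left; lra|right].
    by nra.
rewrite in_itv/= => /andP[c0 _] cE.
have {}c0 : 0 < c.
  rewrite lt_neqAle c0 andbT; apply/eqP => c0'; move: cE.
  by rewrite -c0' oppr0 expR0; lra.
have [k0 kE] : [set s : R | 0 < s /\
    expR s * (expR (2 * s) - 1 + 2 * s * expR s) = (1 + expR s) ^+ 2] (s_K R).
  apply: xgetPex; exists c; split => //.
  by apply/eqP; rewrite -subr_eq0 s_K_equivE cE mulr0.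
split => //; apply/eqP; rewrite -subr_eq0.
have /eqP : expR (s_K R) * (expR (s_K R) * (expR (s_K R) + 2 * s_K R - 1)
    - (3 + expR (- s_K R))) = 0 by rewrite -s_K_equivE kE subrr.
by rewrite mulf_eq0 expR_eq0.
Qed.

(** The definition of [xi] only bounds it by [e^(2 s_star)]; the sharper bound [e^(2s)] is what
    keeps the crossing point [x0] of the tail nonnegative. *)
Lemma xiP s : s_K R < s -> s <= s_star R ->
  [/\ 1 <= xi s, xi s <= expR (2 * s) &
   (expR s - xi s) * ln (xi s) + xi s * (3 + expR (- s))
     = expR s * (expR s + 2 * s - 1)].
Proof.
move=> ks ss; have [k0 kE] := s_KE; have s0 := lt_trans k0 ks.
have q0 := expR_gt0 s.
have e2 t : expR (2 * t) = expR t * expR t.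
  by rewrite -expRD; congr expR; ring.
have lo : 3 + expR (- s) <= expR s * (expR s + 2 * s - 1).
  rewrite leNgt; apply/negP => h.
  have k_s : expR (s_K R) <= expR s by rewrite ler_expR ltW.
  have kN : expR (- s) <= expR (- s_K R) by rewrite ler_expR lerN2 ltW.
  have := expR_gt0 (s_K R); have := expR_ge1Dx (s_K R).
  by nra.
(* The root is sought as [x = e^u]. At [u = 0] the left side is too small because [s > s_K] ([lo]);
   at [u = 2s] it is large enough exactly when [s e^s <= 1 + e^s]. *)
have [u] : exists2 u : R, u \in `[0, 2 * s] &
    (expR s - expR u) * u + expR u * (3 + expR (- s))
      = expR s * (expR s + 2 * s - 1).
  apply: (@IVT R (fun u => (expR s - expR u) * u + expR u * (3 + expR (- s)))).
  - by rewrite mulr_ge0// ltW.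
  - apply: continuous_subspaceT => u; apply: cvgD; apply: cvgM.
    + by apply: cvgB; [exact: cvg_cst|exact: continuous_expR].
    + exact: cvg_id.
    + exact: continuous_expR.
    + exact: cvg_cst.
  - rewrite mulr0 add0r expR0 mul1r ge_min lo/= le_max; apply/orP; right.
    rewrite e2; have := mulr_expR_s_star ss.
    have -> : expR s * expR s * (3 + expR (- s)) = 3 * expR s * expR s + expR s.
      by rewrite expRN; field; rewrite gt_eqF.
    by nra.
rewrite in_itv/= => /andP[u0 us] uE.
have [x1 [xs xE]] : [set x : R | 1 <= x /\ x <= expR (2 * s_star R) /\
    (expR s - x) * ln x + x * (3 + expR (- s)) = expR s * (expR s + 2 * s - 1)] (xi s).
  apply: xgetPex; exists (expR u); split; first by rewrite -expR0 ler_expR.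
  split; last by rewrite expRK.
  by rewrite ler_expR; apply: (le_trans us); rewrite ler_pM2l.
split => //; rewrite leNgt; apply/negP => h.
(* With [xi s = e^(2 t)], [s < t <= s_star], the defect of the equation drops by
   [2 d p + p (m - 1)^2 + p^2 (m^2 - 1) > 0] when [s] is replaced by [t], where
   [d = t - s], [p = e^s], [m = e^d]; yet it is nonnegative at [t]. *)
have xi0 : 0 < xi s := lt_le_trans ltr01 x1.
pose t := ln (xi s) / 2.
have tE : xi s = expR t * expR t.
  by rewrite -e2 /t mulrC divfK// lnK ?posrE.
have lnE : ln (xi s) = 2 * t by rewrite /t mulrC divfK.
have st : s < t by move: h; rewrite tE -e2 ltr_expR ltr_pM2l.
have tss : t <= s_star R by move: xs; rewrite tE -e2 ler_expR ler_pM2l.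
have T := mulr_expR_s_star tss.
pose m := expR (t - s).
have m1 : 1 < m by rewrite /m expR_gt1 subr_gt0.
have pm : expR t = expR s * m by rewrite /m -expRD; congr expR; ring.
move: xE; rewrite lnE tE expRN pm => xE.
move: T; rewrite pm => T.
have {}xE : (expR s - (expR s * m) ^+ 2) * (2 * t) + 3 * (expR s * m) ^+ 2
    + expR s * m ^+ 2 = expR s * (expR s + 2 * s - 1).
  by rewrite -xE; field; rewrite gt_eqF.
move: xE T m1 q0 st; move: (expR s) => p xE T m1 p0 st.
have P1 : 0 < p * (t - s) by rewrite mulr_gt0// subr_gt0.
have P2 : 0 <= p * (m - 1) ^+ 2 by rewrite mulr_ge0 ?sqr_ge0// ltW.
have P3 : 0 <= p ^+ 2 * (m - 1) * (m + 1).
  by rewrite !mulr_ge0 ?sqr_ge0//; lra.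
have P4 : 0 <= p * m * (1 + p * m - t * (p * m)).
  by rewrite !mulr_ge0 ?subr_ge0//; lra.
by nra.
Qed.

End SpecialValues.

(** * The two ranges of [s] *)

Theorem theorem4 (R : realType) (s : R) :
  0 < s -> s <= s_star R ->
  exists Gp Gm : R -> R, excursion_profile (rho s) (chi s) Gp Gm.
Proof.
move=> s0 ss; have q0 := expR_gt0 s; have [k0 kE] := @s_KE R.
have q2 : expR (2 * s) = expR s * expR s by rewrite -expRD; congr expR; ring.
have [sk|ks] := leP s (s_K R).
  have e1 : 1 <= expR (2 * s) by rewrite -expR0 ler_expR mulr_ge0// ltW.
  (* With [1] for [K] the formula for [ch] becomes the first branch of [chi], and the required
     inequality, multiplied by [1 + e^s], is the threshold inequality [H]. *)
  apply: (excursion_profile_tails s0 (lexx 1) e1).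
    by rewrite /chi sk ln1; congr (_ / _); ring.
  rewrite /chi sk ln1 mul1r expRN q2.
  have H : expR s * (expR s + 2 * s - 1) <= 3 + (expR s)^-1.
    by rewrite -expRN; apply: (K_threshold_mono s0 sk); rewrite kE.
  have -> : 2 * s * ((expR s * expR s - 1 - 2 * s) / (2 * s * (1 + expR s))) =
      (expR s * expR s - 1 - 2 * s) / (1 + expR s).
    by field; rewrite !gt_eqF// addr_gt0.
  rewrite ler_pdivrMr ?addr_gt0//.
  have -> : ((expR s)^-1 - 2 * s + 0 + 1) * (1 + expR s) =
     (expR s)^-1 + 2 + expR s - 2 * s - 2 * s * expR s.
    by field; rewrite gt_eqF.
  by lra.
have [x1 xs xE] := xiP ks ss.
have nsk : (s <= s_K R) = false by rewrite leNgt ks.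
apply: (excursion_profile_tails s0 x1 xs); first by rewrite /chi /Kfun nsk.
(* With [xi s] for [K] the required inequality is an equality: multiplied by [1 + e^s] it rearranges
   to the equation defining [xi]. *)
rewrite /chi /Kfun nsk le_eqVlt; apply/orP; left; apply/eqP.
move: xE; set X := xi s; set L := ln X => xE.
rewrite q2; apply: (mulIf (x := 1 + expR s)); first by rewrite gt_eqF// addr_gt0.
rewrite [LHS](_ : _ = expR s * expR s + 1 + (1 + X) * L - 2 * X - 2 * s); last first.
  by field; rewrite !gt_eqF// addr_gt0.
have XV : X * expR (- s) * (1 + expR s) = X * expR (- s) + X.
  by rewrite expRN; field; rewrite gt_eqF.
by move: XV xE; lra.
Qed.
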